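(* Let $K$ be a field with a non-trivial valuation $v$ and let $A(x)=\sum_{i=0}^n a_ix^i\in K[x]$ be a polynomial of degree $n$. Assume that the characteristic of the residue field of $v$ does not divide $n$. If the orbit $A(x)L(2,K)$ contains an Eisenstein–Dumas polynomial at $v$, then $a_0\neq0$ and $$L(A(x))=A(x)\begin{pmatrix}1&0\\-\frac{a_1}{na_0}&1\end{pmatrix}=\Big(1-\frac{a_1}{na_0}x\Big)^nA\Big(\frac{x}{1-\frac{a_1}{na_0}x}\Big)$$ is an Eisenstein–Dumas polynomial at $v$.
   Context: $v:K\to\Gamma\cup\{\infty\}$ is a non-trivial Krull valuation with values in a linearly ordered abelian group $\Gamma$; $K$ is not assumed henselian; the residue field is $R_v/M_v$ with $R_v=\{v\ge0\}$, $M_v=\{v>0\}$. $L(2,K)$ is the group of invertible lower triangular $2\times2$ matrices over $K$. Action: for $A$ of degree $n$, $A(x)\begin{pmatrix}a&b\\c&d\end{pmatrix}=(cx+d)^nA\big(\frac{ax+b}{cx+d}\big)$, regarded as a polynomial of formal degree $n$; $A(x)L(2,K)=\{A(x)g:g\in L(2,K)\}$. A polynomial written $\sum_{i=0}^n b_ix^i$ is Eisenstein–Dumas at $v$ if (D0) $b_0b_n\neq0$; (D1) $v(b_0)-v(b_n)\notin k\Gamma=\{kg:g\in\Gamma\}$ for every integer $k>1$ dividing $n$; (D2) $nv(b_i)\ge (n-i)v(b_0)+iv(b_n)$ for $0\le i\le n$.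
   Formalization: The claim that L(A(x)) is Eisenstein–Dumas is proved only for n > 1; for n = 1 it is false, since A = a_0 + a_1x with a_0a_1 ≠ 0 is Eisenstein–Dumas while L(A) = a_0 is not. *)

(* Defs.v *)
From HB Require Import structures.
From mathcomp Require Import all_boot all_order all_algebra.
From mathcomp Require Import generic_quotient ring_quotient.

Set Implicit Arguments.
Unset Strict Implicit.
Unset Printing Implicit Defensive.

Import Order.TTheory GRing.Theory Num.Theory.
Local Open Scope ring_scope.

HB.mixin Record isTotallyOrderedGroup G of Num.POrderedZmodule G := {
  og_total : forall x y : G, (x <= y) || (y <= x);
  og_leD2l : forall z x y : G, x <= y -> z + x <= z + y
}.

#[short(type="orderedGroupType")]
HB.structure Definition OrderedGroup :=
  {G of Num.POrderedZmodule G & isTotallyOrderedGroup G}.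

Arguments og_leD2l {s} z {x y}.

(* [Some g] is the element g of Gamma and [None] is the symbol infinity. *)
Definition with_infty (G : Type) : Type := option G.

Definition infty {G : Type} : with_infty G := None.

Section WithInfty.
Variable G : orderedGroupType.
Implicit Types x y z : with_infty G.

Definition wi_add x y : with_infty G :=
  if x is Some a then if y is Some b then Some (a + b) else None else None.
Definition wi_le x y : bool :=
  if y is Some b then if x is Some a then a <= b else false else true.
Definition wi_lt x y : bool := (y != x) && wi_le x y.

HB.instance Definition _ := Choice.copy (with_infty G) (option G).

Fact wi_addA : associative wi_add.
Proof. by move=> [a|] [b|] [c|] //=; rewrite addrA. Qed.
Fact wi_addC : commutative wi_add.
Proof. by move=> [a|] [b|] //=; rewrite addrC. Qed.
Fact wi_add0 : left_id (Some 0) wi_add.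
Proof. by move=> [a|] //=; rewrite add0r. Qed.

HB.instance Definition _ :=
  GRing.isNmodule.Build (with_infty G) wi_addA wi_addC wi_add0.

Fact wi_le_anti : antisymmetric wi_le.
Proof. by move=> [a|] [b|] //= /le_anti ->. Qed.
Fact wi_le_trans : transitive wi_le.
Proof. by move=> [a|] [b|] [c|] //=; apply: le_trans. Qed.
Fact wi_le_total : total wi_le.
Proof. by move=> [a|] [b|] //=; apply: og_total. Qed.

HB.instance Definition _ :=
  Order.isOrder.Build ring_display (with_infty G)
    (fun _ _ => erefl) (fun _ _ => erefl) (fun _ _ => erefl)
    wi_le_anti wi_le_trans wi_le_total.

(* Only meaningful on finite values. *)
Definition finite_part x : G := odflt 0 x.

End WithInfty.

Record valuation (K : fieldType) (G : orderedGroupType) := Valuation {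
  valuation_fun :> K -> with_infty G;
  v_infty : forall x, valuation_fun x = infty <-> x = 0;
  vM : forall x y, valuation_fun (x * y) = valuation_fun x + valuation_fun y;
  vD : forall x y,
    Order.min (valuation_fun x) (valuation_fun y) <= valuation_fun (x + y)
}.

Definition nontrivial_valuation K G (v : valuation K G) : Prop :=
  exists x : K, x != 0 /\ v x != 0.

Section ResidueField.
Variables (K : fieldType) (G : orderedGroupType) (v : valuation K G).

Fact v1 : v 1 = 0.
Proof.
have := vM v 1 1; rewrite mulr1.
case E: (v 1) => [a|] => [[/eqP]|]; last by have /eqP := (v_infty v 1).1 E; rewrite oner_eq0.
by rewrite -subr_eq0 opprD addNKr oppr_eq0 => /eqP ->.
Qed.

Fact vN1 : v (-1) = 0.
Proof.
have := vM v (-1) (-1); rewrite mulrNN mulr1 v1.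
case: (v (-1)) => [a|] // [] a2.
congr Some; apply/le_anti; case/orP: (og_total a 0) => h; rewrite h ?andbT /=.
  by have := og_leD2l a h; rewrite -a2 addr0.
by have := og_leD2l a h; rewrite -a2 addr0.
Qed.

Fact vN x : v (- x) = v x.
Proof. by rewrite -mulN1r vM vN1 add0r. Qed.

Fact wi_add_ge0 (x y : with_infty G) : (0 : with_infty G) <= x -> (0 : with_infty G) <= y ->
  (0 : with_infty G) <= x + y.
Proof.
move: x y => [a|] [b|] // a0 b0.
by apply: (le_trans a0); have := og_leD2l a b0; rewrite addr0.
Qed.

Fact wi_add_gt0 (x y : with_infty G) : (0 : with_infty G) <= x -> (0 : with_infty G) < y ->
  (0 : with_infty G) < x + y.
Proof.
move=> x0 y0; rewrite lt_neqAle wi_add_ge0 ?(ltW y0) // andbT.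
apply/eqP; move: x y x0 y0 => [a|] [b|] //= a0 b0 [] e.
have: (Some b : with_infty G) <= (0 : with_infty G).
  by rewrite /Order.le /= e -[X in X <= _]add0r; rewrite ![_ + b]addrC; exact: og_leD2l.
by rewrite leNgt b0.
Qed.

Definition val_ring_pred : {pred K} := fun x => (0 : with_infty G) <= v x.

Fact val_ring_subring : subring_closed val_ring_pred.
Proof.
split; rewrite /val_ring_pred ?unfold_in ?v1 //.
- move=> x y; rewrite !unfold_in => x0 y0.
  by apply: le_trans (vD v x (- y)); rewrite vN le_min x0.
- by move=> x y; rewrite !unfold_in vM; apply: wi_add_ge0.
Qed.

HB.instance Definition _ :=
  GRing.isSubringClosed.Build K val_ring_pred val_ring_subring.

Record val_ring := ValRing { val_ring_val : K; _ : val_ring_val \in val_ring_pred }.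

HB.instance Definition _ := [isSub for val_ring_val].
HB.instance Definition _ := [Choice of val_ring by <:].
HB.instance Definition _ := [SubChoice_isSubComNzRing of val_ring by <:].

Definition max_ideal_pred : {pred val_ring} := fun x => (0 : with_infty G) < v (val x).

Fact max_ideal_idealr : idealr_closed max_ideal_pred.
Proof.
split; rewrite /max_ideal_pred ?unfold_in.
- by rewrite (_ : v (val 0) = infty) //; apply/v_infty.
- by rewrite v1 ltxx.
- move=> a x y; rewrite !unfold_in => x0 y0.
  apply: lt_le_trans (vD v _ _); rewrite lt_min y0 vM wi_add_gt0 //.
  exact: (valP a).
Qed.

HB.instance Definition _ := isIdealr.Build val_ring max_ideal_pred max_ideal_idealr.

Definition residue_field := {ideal_quot max_ideal_pred}.

HB.instance Definition _ := GRing.ComNzRing.on residue_field.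

Local Open Scope quotient_scope.

Fact residue_inv_ex (x : residue_field) : exists y : residue_field,
  if x == 0 then y == 0 else y * x == 1.
Proof.
case: (eqVneq x 0) => [_|]; first by exists 0.
rewrite -[x](@reprK _ {ideal_quot max_ideal_pred}).
set y := repr _; move: y => {}x x0.
have vx0 : v (val x) = 0.
  apply/eqP; have := valP x; rewrite unfold_in le_eqVlt eq_sym => /orP[//|vx].
  case/negP: x0; have := Quotient.idealrBE max_ideal_pred x 0.
  by rewrite subr0 [LHS]vx raddf0 => <-.
have xn0 : val x != 0.
  by apply/eqP => /(v_infty v); rewrite vx0.
have vi : (val x)^-1 \in val_ring_pred.
  have := vM v (val x)^-1 (val x).
  by rewrite mulVf // v1 vx0 addr0 unfold_in => <-.
exists (\pi_{ideal_quot max_ideal_pred} (ValRing vi)).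
apply/eqP; rewrite -(rmorphM (\pi_{ideal_quot max_ideal_pred})).
rewrite (_ : _ * _ = 1) ?rmorph1 //.
by apply/val_inj; rewrite /= mulVf.
Qed.

Definition residue_inv (x : residue_field) : residue_field :=
  xchoose (residue_inv_ex x).

Fact residue_mulVf x : x != 0 -> residue_inv x * x = 1.
Proof.
move=> x0; apply/eqP; rewrite /residue_inv; move: (xchoose _) (xchooseP (residue_inv_ex x)).
by rewrite (negPf x0).
Qed.

Fact residue_inv0 : residue_inv 0 = 0.
Proof.
apply/eqP; rewrite /residue_inv; move: (xchoose _) (xchooseP (residue_inv_ex 0)).
by rewrite eqxx.
Qed.

HB.instance Definition _ :=
  GRing.ComNzRing_isField.Build residue_field residue_mulVf residue_inv0.

End ResidueField.

Section Action.
Variable K : fieldType.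
Implicit Types (A B : {poly K}) (g : 'M[K]_2) (n : nat).

Definition lower_triangular_group g : Prop := is_trig_mx g /\ g \in unitmx.

Definition mx2 (a b c d : K) : 'M[K]_2 :=
  \matrix_(i < 2, j < 2) if i == 0 then (if j == 0 then a else b)
                         else (if j == 0 then c else d).

(* (cx + d)^n A((ax + b)/(cx + d)), with the denominators cleared term by term;
   see [mx_actE] for the agreement with the formula in K(x). *)
Definition mx_act n A g : {poly K} :=
  \sum_(i < n.+1) A`_i *: ((g 0 0 *: 'X + (g 0 1)%:P) ^+ i *
                           (g 1 0 *: 'X + (g 1 1)%:P) ^+ (n - i)).

Definition in_lower_orbit n A B : Prop :=
  exists g, lower_triangular_group g /\ B = mx_act n A g.

Definition eval_ratfun A (y : {fraction {poly K}}) : {fraction {poly K}} :=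
  (map_poly (fun c : K => tofrac c%:P) A).[y].

Lemma mx_actE n A g : (size A <= n.+1)%N -> g \in unitmx ->
  let num := tofrac (g 0 0 *: 'X + (g 0 1)%:P) in
  let den := tofrac (g 1 0 *: 'X + (g 1 1)%:P) in
  tofrac (mx_act n A g) = den ^+ n * eval_ratfun A (num / den).
Proof.
move=> sA gU num den.
have den0 : den != 0.
  rewrite /den tofrac_eq0; apply: contraTneq gU => d0.
  have c0 : g 1 0 = 0.
    by have := congr1 (coefp 1) d0; rewrite /= !coefE /= mulr1 addr0.
  have e0 : g 1 1 = 0.
    by have := congr1 (coefp 0%N) d0; rewrite /= !coefE /= mulr0 add0r.
  rewrite unitmxE (expand_det_row _ 1) !big_ord_recl big_ord0 /=.
  rewrite (_ : lift ord0 ord0 = 1); last exact: val_inj.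
  by rewrite (_ : ord0 = 0) // c0 e0 !mul0r !addr0 unitr0.
rewrite /eval_ratfun (@horner_coef_wide _ n.+1); last first.
  by apply: leq_trans (size_poly _ _) _.
rewrite mulr_sumr rmorph_sum /=; apply: eq_bigr => i _.
have -> : (map_poly (fun c : K => tofrac c%:P) A)`_i = tofrac (A`_i)%:P.
  by rewrite coef_map_id0 // polyC0 tofrac0.
rewrite -mul_polyC !tofracM !tofracXn -/num -/den.
rewrite expr_div_n [RHS]mulrCA; congr (_ * _).
rewrite mulrCA; congr (_ * _).
have lein : (i <= n)%N by rewrite -ltnS.
apply: (mulIf (expf_neq0 i den0)).
by rewrite -mulrA mulVf ?expf_neq0 // mulr1 -exprD subnK.
Qed.

Definition L_transform n A : {poly K} :=
  mx_act n A (mx2 1 0 (- (A`_1 / (n%:R * A`_0))) 1).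

End Action.

(* B is read as \sum_(i <= n) b_i x^i. *)
Definition eisenstein_dumas (K : fieldType) (G : orderedGroupType)
    (v : valuation K G) (n : nat) (B : {poly K}) : Prop :=
  [/\ (size B <= n.+1)%N,
      B`_0 * B`_n != 0,
      forall k : nat, (1 < k)%N -> (k %| n)%N ->
        ~ exists g : G, finite_part (v B`_0) - finite_part (v B`_n) = g *+ k
    & forall i : nat, (i <= n)%N ->
        v B`_0 *+ (n - i) + v B`_n *+ i <= v B`_i *+ n].

(* In degree 1 the transform kills the leading coefficient, whereas every
   polynomial of degree 1 with nonzero constant term is Eisenstein-Dumas. *)
Lemma degree1_eisenstein_dumas (K : fieldType) (G : orderedGroupType)
    (v : valuation K G) (A : {poly K}) :
  size A = 2%N -> A`_0 != 0 ->
  eisenstein_dumas v 1 A /\ ~ eisenstein_dumas v 1 (L_transform 1 A).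
Proof.
move=> sA a0; split.
  split; first by rewrite sA.
  - rewrite mulf_neq0 //; have := lead_coef_eq0 A.
    by rewrite lead_coefE sA -size_poly_eq0 sA => ->.
  - by move=> k k1; rewrite dvdn1 => /eqP k0; rewrite k0 in k1.
  - by move=> [|[|//]] _; rewrite ?subn0 ?subnn !mulr0n !mulr1n ?addr0 ?add0r.
case=> _ + _ _; apply/negP; rewrite negbK; apply/eqP.
rewrite [X in _ * X](_ : _ = 0) ?mulr0 //.
rewrite /L_transform /mx_act !big_ord_recl big_ord0 /= !mxE /=.
rewrite scale1r addr0 expr0 mul1r subn0 subnn expr0 mulr1 !expr1 mul1r addr0.
rewrite !(coefD, coefZ, coefX, coefC) /= mulr1 !addr0 mulr1.
by rewrite mulrN mulrCA divff // mulr1 addNr.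
Qed.

(* Main.v *)
(** Write L(A) = B g' with B Eisenstein-Dumas and g' lower triangular with rows
    (a, 0) and (c, d). The coefficient of x in L(A) vanishes, which forces
    c = - b_1 a / (n b_0). Since n is a unit at v, (D2) for b_1 gives
    v(c^n b_0) >= v(a^n b_n), and the inequality is strict because equality
    would put v(b_0) - v(b_n) in n Gamma. So g' moves the Newton segment of B to
    the segment from v(b_0 d^n) to v(b_n a^n): every term of every coefficient
    lies on or above it, and those involving c lie strictly above, so that the
    leading coefficient has value exactly v(b_n a^n). *)

Require Import Defs.
From mathcomp Require Import all_boot all_order all_algebra.
From mathcomp Require Import ring.

Set Implicit Arguments.
Unset Strict Implicit.
Unset Printing Implicit Defensive.

Import Order.TTheory GRing.Theory Num.Theory.
Local Open Scope ring_scope.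

(** * Values of powers, quotients, sums and integers *)

Section Valuation.
Variables (K : fieldType) (G : orderedGroupType) (v : valuation K G).
Implicit Types x y z : K.

Local Notation wi0 := (0 : with_infty G).

Lemma vX x n : v (x ^+ n) = v x *+ n.
Proof.
by elim: n => [|n IHn]; rewrite ?expr0 ?v1 // exprS vM IHn mulrS.
Qed.

Lemma v0 : v 0 = infty.
Proof. exact/v_infty. Qed.

Lemma v_finite x : x != 0 -> v x = Some (finite_part (v x)).
Proof. by case E: (v x) => [//|] /eqP []; exact: (v_infty v x).1 E. Qed.

Lemma finite_partM x y : x != 0 -> y != 0 ->
  finite_part (v (x * y)) = finite_part (v x) + finite_part (v y).
Proof. by move=> x0 y0; rewrite vM (v_finite x0) (v_finite y0). Qed.

Lemma finite_partX x n : x != 0 ->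
  finite_part (v (x ^+ n)) = finite_part (v x) *+ n.
Proof.
move=> x0; elim: n => [|n IHn]; first by rewrite expr0 v1.
by rewrite exprS finite_partM ?expf_neq0 // IHn mulrS.
Qed.

Lemma finite_partV x : x != 0 -> finite_part (v x^-1) = - finite_part (v x).
Proof.
move=> x0; apply/eqP; rewrite -addr_eq0 -finite_partM ?invr_eq0 //.
by rewrite mulVf // v1.
Qed.

Lemma v_ge0M x y : wi0 <= v x -> wi0 <= v y -> wi0 <= v (x * y).
Proof. by rewrite vM; apply: wi_add_ge0. Qed.

Lemma v_gt0M x y : wi0 <= v x -> wi0 < v y -> wi0 < v (x * y).
Proof. by rewrite vM; apply: wi_add_gt0. Qed.

Lemma v_ge0X x n : wi0 <= v x -> wi0 <= v (x ^+ n).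
Proof.
by move=> x0; elim: n => [|n IHn]; rewrite ?expr0 ?v1 // exprS v_ge0M.
Qed.

Lemma v_gt0X x n : (0 < n)%N -> wi0 < v x -> wi0 < v (x ^+ n).
Proof.
case: n => // n _ x0; rewrite exprSr v_gt0M //; exact/v_ge0X/ltW.
Qed.

Lemma v_ge0_nat n : wi0 <= v n%:R.
Proof.
elim: n => [|n IHn]; first by rewrite v0.
by rewrite mulrS; apply: le_trans (vD v _ _); rewrite le_min v1 lexx.
Qed.

(** Multiplying by $x^{-1}$ translates values by $-v(x)$. Comparisons thus become signs of the value
    of one quotient, which field identities can rewrite. *)
Lemma v_leE x y : x != 0 -> (v x <= v y) = (wi0 <= v (y / x)).
Proof.
move=> x0; have xV0 : x^-1 != 0 by rewrite invr_eq0.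
have [->|y0] := eqVneq y 0; first by rewrite mul0r v0; case: (v x).
have yx0 : y / x != 0 by rewrite mulf_neq0.
rewrite (v_finite yx0) finite_partM // finite_partV //.
rewrite (v_finite x0) (v_finite y0) /Order.le /=.
apply/idP/idP => le_xy.
  by have := og_leD2l (- finite_part (v x)) le_xy; rewrite addNr addrC.
by have := og_leD2l (finite_part (v x)) le_xy; rewrite addr0 addrC subrK.
Qed.

Lemma v_ltE x y : x != 0 -> (v x < v y) = (wi0 < v (y / x)).
Proof.
move=> x0; have [->|y0] := eqVneq y 0.
  by rewrite mul0r v0 (v_finite x0).
rewrite !ltNge v_leE // -[in RHS](v1 v) [in RHS]v_leE ?mulf_neq0 ?invr_eq0 //.
by rewrite mul1r invf_div.
Qed.

Lemma v_leX x y n : v x <= v y -> v (x ^+ n) <= v (y ^+ n).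
Proof.
have [->|x0] := eqVneq x 0.
  by rewrite v0; case E: (v y) => [//|] _; rewrite ((v_infty v y).1 E).
by rewrite !v_leE ?expf_neq0 // -expr_div_n; apply: v_ge0X.
Qed.

Lemma v_ltX x y n : x != 0 -> v (x ^+ n) < v (y ^+ n) -> v x < v y.
Proof. by move=> x0; rewrite !ltNge; apply/contra => /v_leX. Qed.

(** The minimum in [vD] is one of the two values, so a property that passes to elements of larger
    value survives addition. It is used both for $v(y)>t$ and for $v(y^n)\ge t$. *)
Lemma v_sum_upward (P : K -> Prop) I (r : seq I) (Q : pred I) (F : I -> K) :
  P 0 -> (forall x y, P x -> v x <= v y -> P y) ->
  (forall i, Q i -> P (F i)) -> P (\sum_(i <- r | Q i) F i).
Proof.
move=> P0 Pup PF; elim/big_ind: _ => [//|x y Px Py|//].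
by have := vD v x y; rewrite ge_min => /orP[]; apply: Pup.
Qed.

Lemma vD_ltl x y : v x < v y -> v (x + y) = v x.
Proof.
move=> ltxy; apply/le_anti/andP; split; last first.
  by apply: le_trans (vD v x y); rewrite le_min lexx ltW.
have := vD v (x + y) (- y); rewrite addrK vN ge_min => /orP[//|].
by rewrite leNgt ltxy.
Qed.

(** The hypothesis makes $n$ nonzero in the residue field, hence outside the maximal ideal; its
    value, which is at least 0, cannot be positive. *)
Lemma v_natr_eq0 n :
  [pchar (residue_field v)]^'.-nat n -> v n%:R = 0.
Proof.
rewrite -natf_neq0_pchar => n0.
apply/eqP; have := v_ge0_nat n; rewrite le_eqVlt eq_sym => /orP[//|vn].
case/negP: n0.
have -> : (n%:R : residue_field v) =
    (\pi_({ideal_quot @max_ideal_pred K G v}) (n%:R : val_ring v))%qT.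
  by rewrite rmorph_nat.
have := Quotient.idealrBE (@max_ideal_pred K G v) (n%:R : val_ring v) 0.
rewrite subr0 raddf0 => <-.
by rewrite unfold_in /max_ideal_pred rmorph_nat.
Qed.

End Valuation.

(** * Coefficients of the transform and composition of the action *)

Section Action.
Variable K : fieldType.
Implicit Types (A B : {poly K}) (g h : 'M[K]_2) (n : nat).

(** Summand $i$ is $A_i(aX)^i(cX+d)^{n-i}$, a multiple of $X^i$; it reaches index $j$ through the
    binomial term with $j-i$ factors $c$. *)
Lemma coef_mx_act n A g j : g 0 1 = 0 -> (j <= n)%N ->
  (mx_act n A g)`_j = \sum_(i < j.+1)
    A`_i * (g 0 0 ^+ i * (g 1 0 ^+ (j - i) * g 1 1 ^+ (n - j))
            *+ 'C(n - i, j - i)).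
Proof.
move=> g01 le_jn; rewrite /mx_act coef_sum.
rewrite (big_ord_widen n.+1 (fun i => A`_i * (g 0 0 ^+ i *
  (g 1 0 ^+ (j - i) * g 1 1 ^+ (n - j)) *+ 'C(n - i, j - i)))) //.
rewrite [RHS]big_mkcond; apply: eq_bigr => i _ /=.
rewrite g01 addr0 coefZ exprZn -scalerAl coefZ coefXnM ltnS ltnNge.
case: (leqP i j) => [le_ij|lt_ji] /=; last by rewrite !mulr0.
congr (_ * _); rewrite -mulrnAr; congr (_ * _).
rewrite addrC exprDn coef_sum.
have lt_k : (j - i < (n - i).+1)%N by rewrite ltnS leq_sub2r.
rewrite (bigD1 (Ordinal lt_k)) //= big1 ?addr0 => [|k ne_k].
  rewrite coefMn exprZn -polyC_exp coefCM coefZ coefXn eqxx mulr1 mulrC.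
  by rewrite subnBA // subnK // (leq_trans le_ij).
rewrite coefMn exprZn -polyC_exp coefCM coefZ coefXn.
by rewrite eq_sym -(inj_eq val_inj) /= in ne_k *;
  rewrite (negPf ne_k) !mulr0 mul0rn.
Qed.

Lemma coef0_mx_act n A g : g 0 1 = 0 -> (mx_act n A g)`_0 = A`_0 * g 1 1 ^+ n.
Proof.
move=> g01; rewrite coef_mx_act // big_ord_recl big_ord0 /=.
by rewrite !subn0 bin0 !mul1r addr0.
Qed.

Lemma coef1_mx_act n A g : g 0 1 = 0 -> (0 < n)%N ->
  (mx_act n A g)`_1 =
    (A`_1 * g 0 0 + n%:R * A`_0 * g 1 0) * g 1 1 ^+ n.-1.
Proof.
move=> g01 n_gt0; rewrite coef_mx_act // !big_ord_recl big_ord0 /=.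
rewrite !subn0 subnn subn1 bin0 bin1 expr0 !expr1 addr0 -mulr_natr; ring.
Qed.

Lemma size_linear_form (a b : K) : (size (a *: 'X + b%:P)%R <= 2)%N.
Proof.
rewrite (leq_trans (size_polyD _ _)) // geq_max.
by rewrite (leq_trans (size_scale_leq _ _)) ?size_polyX
  ?(leq_trans (size_polyC_leq1 _)).
Qed.

Lemma size_mx_act n A g : (size (mx_act n A g) <= n.+1)%N.
Proof.
apply: (leq_trans (size_sum _ _ _)); apply/bigmax_leqP => i _.
apply: (leq_trans (size_scale_leq _ _)); apply: (leq_trans (size_polyMleq _ _)).
have sX (p : {poly K}) m : (size p <= 2 -> size (p ^+ m) <= m.+1)%N.
  move=> sp; apply: (leq_trans (size_poly_exp_leq _ _)).
  by rewrite ltnS -[leqRHS]mul1n leq_mul2r -subn1 leq_subLR sp orbT.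
have s1 := sX _ i (size_linear_form (g 0 0) (g 0 1)).
have s2 := sX _ (n - i)%N (size_linear_form (g 1 0) (g 1 1)).
have := leq_add s1 s2; rewrite addSn addnS subnKC -1?ltnS //.
by case: (_ + _)%N.
Qed.

Lemma eval_mx_act n A g (y : {fraction {poly K}}) :
  eval_ratfun (mx_act n A g) y =
  \sum_(i < n.+1) tofrac (A`_i)%:P *
    ((tofrac (g 0 0)%:P * y + tofrac (g 0 1)%:P) ^+ i *
     (tofrac (g 1 0)%:P * y + tofrac (g 1 1)%:P) ^+ (n - i)).
Proof.
rewrite /eval_ratfun.
(* Bundling the embedding of constants as a ring morphism makes evaluation additive and
   multiplicative. *)
pose f : {rmorphism K -> {fraction {poly K}}} := @tofrac {poly K} \o @polyC K.
rewrite -[X in map_poly X]/(f : K -> {fraction {poly K}}) /mx_act raddf_sum.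
rewrite horner_sum.
apply: eq_bigr => i _ /=.
rewrite -mul_polyC !(rmorphM, rmorphXn, rmorphD) /=.
by rewrite !map_polyZ !map_polyC map_polyX /= !hornerE.
Qed.

Lemma det_mx22 g : \det g = g 0 0 * g 1 1 - g 0 1 * g 1 0.
Proof.
rewrite (expand_det_row _ 0) !big_ord_recl big_ord0 addr0 /cofactor !det_mx11 !mxE.
rewrite (_ : lift ord0 ord0 = 1); last exact: val_inj.
rewrite (_ : lift 1 _ = 0); last exact: val_inj.
by rewrite expr0 mul1r expr1 mulN1r mulrN.
Qed.

Lemma denominator_neq0 g : g \in unitmx -> g 1 0 *: 'X + (g 1 1)%:P != 0.
Proof.
apply: contraTneq => den0; rewrite unitmxE det_mx22.
have -> : g 1 0 = 0.
  by have := congr1 (coefp 1) den0; rewrite /= !coefE /= mulr1 addr0.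
have -> : g 1 1 = 0.
  by have := congr1 (coefp 0%N) den0; rewrite /= !coefE /= mulr0 add0r.
by rewrite !mulr0 subr0 unitr0.
Qed.

(** The identity is checked in $K(x)$, where the action of [h] is $Q^n$ times evaluation at $P/Q$.
    Splitting $Q^n=Q^iQ^{n-i}$ clears the denominators of both linear forms of [g], and [lin]
    recognises the results as the rows of [g *m h]. *)
Lemma mx_actM n A g h : h \in unitmx ->
  mx_act n (mx_act n A g) h = mx_act n A (g *m h).
Proof.
move=> hU; apply/eqP; rewrite -tofrac_eq; apply/eqP.
rewrite mx_actE ?size_mx_act //.
set P := tofrac (h 0 0 *: 'X + (h 0 1)%:P).
set Q := tofrac (h 1 0 *: 'X + (h 1 1)%:P).
have Q0 : Q != 0 by rewrite tofrac_eq0 denominator_neq0.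
have lin j : Q * (tofrac (g j 0)%:P * (P / Q) + tofrac (g j 1)%:P) =
    tofrac ((g *m h) j 0 *: 'X + ((g *m h) j 1)%:P).
  rewrite mulrDr mulrCA [Q * (P / Q)]mulrC divfK // [Q * _]mulrC.
  rewrite /P /Q -!tofracM -tofracD.
  rewrite !mxE !big_ord_recl !big_ord0 !addr0 -!mul_polyC.
  rewrite (_ : lift ord0 ord0 = 1); last exact: val_inj.
  by rewrite !(polyCD, polyCM); congr tofrac; ring.
rewrite eval_mx_act mulr_sumr /mx_act rmorph_sum; apply: eq_bigr => i _ /=.
rewrite -mul_polyC !tofracM !tofracXn -!lin mulrCA; congr (_ * _).
rewrite !exprMn mulrACA -exprD subnKC // -ltnS; exact: ltn_ord.
Qed.

End Action.

(* The monomial b_i a^i c^k d^l is the contribution of b_i to the coefficient of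
   index [i + k] of the transform, where [i + k + l = m]; it is divided here by
   its counterpart on the Newton segment of the transform. *)
Lemma newton_term (K : fieldType) (b0 bi bm a c d : K) m i k l :
  b0 != 0 -> bm != 0 -> a != 0 -> d != 0 ->
  (bi * (a ^+ i * (c ^+ k * d ^+ l))) ^+ m /
    ((b0 * d ^+ m) ^+ l * (bm * a ^+ m) ^+ (i + k)) =
  bi ^+ m / (b0 ^+ (k + l) * bm ^+ i) * (c ^+ m * b0 / (a ^+ m * bm)) ^+ k.
Proof.
move=> b00 bm0 a0 d0; rewrite !(exprMn, exprVn, exprD) -!exprM ![(m * _)%N]mulnC.
have ne (x : K) p : x != 0 -> x ^+ p != 0 by move=> x0; rewrite expf_neq0.
by field; rewrite !ne.
Qed.

(** * The Newton segment under a transform that kills the linear coefficient *)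

Section LinearCoefficient.
Variables (K : fieldType) (G : orderedGroupType) (v : valuation K G).
Variables (n : nat) (B : {poly K}) (g : 'M[K]_2).
Hypotheses (n_gt1 : (1 < n)%N) (vn : v n%:R = 0) (edB : eisenstein_dumas v n B).
Hypotheses (g01 : g 0 1 = 0) (gU : g \in unitmx).

Local Notation wi0 := (0 : with_infty G).
Local Notation C := (mx_act n B g).
Local Notation a := (g 0 0).
Local Notation c := (g 1 0).
Local Notation d := (g 1 1).

Lemma degree_neq0 : (n%:R : K) != 0.
Proof. by apply/eqP => n0; move: vn; rewrite n0 v0. Qed.

Lemma diagonal_neq0 : (a != 0) * (d != 0).
Proof.
move: gU; rewrite unitmxE det_mx22 g01 mul0r subr0 unitfE mulf_eq0 negb_or.
by case/andP=> -> ->.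
Qed.

Lemma ends_neq0 : (B`_0 != 0) * (B`_n != 0).
Proof. by case: edB => _; rewrite mulf_eq0 negb_or => /andP[-> ->]. Qed.

(** This is (D2) in quotient form: the value is $n$ times the height of $b_i$ above the Newton
    segment. *)
Lemma newton_ge0 i : (i <= n)%N ->
  wi0 <= v (B`_i ^+ n / (B`_0 ^+ (n - i) * B`_n ^+ i)).
Proof.
case: edB => _ _ _ /(_ i) + le_in => /(_ le_in).
by rewrite -!vX -vM v_leE // mulf_neq0 ?expf_neq0 ?ends_neq0.
Qed.

Lemma newton1_gt0 : wi0 < v (B`_1 ^+ n / (B`_0 ^+ n.-1 * B`_n)).
Proof.
have := newton_ge0 (ltnW n_gt1); rewrite subn1 expr1 le_eqVlt => /orP[v_eq0|//].
have [B1|B1] := eqVneq B`_1 0.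
  by rewrite B1 expr0n gtn_eqF ?(ltnW n_gt1) // mul0r v0.
have [_ _ D1 _] := edB; case: (D1 n n_gt1 (dvdnn n)).
(* Equality $nv(b_1)=(n-1)v(b_0)+v(b_n)$ reads $v(b_0)-v(b_n)=n(v(b_0)-v(b_1))$. *)
exists (finite_part (v B`_0) - finite_part (v B`_1)).
move/eqP/(congr1 (@finite_part G)): v_eq0.
rewrite /= finite_partM ?finite_partV; last first.
- by rewrite invr_eq0 mulf_neq0 ?expf_neq0 ?ends_neq0.
- by rewrite expf_neq0.
- by rewrite mulf_neq0 ?expf_neq0 ?ends_neq0.
rewrite finite_partM ?expf_neq0 ?ends_neq0 // !finite_partX ?ends_neq0 //.
move/esym/eqP; rewrite subr_eq0 mulrnBl => /eqP->.
by rewrite -{2}(prednK (ltnW n_gt1)) mulrS opprD addrA addrK.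
Qed.

Hypothesis C1 : C`_1 = 0.

Lemma lower_entry : c = - (B`_1 * a) / (n%:R * B`_0).
Proof.
have n0 := degree_neq0.
have /eqP := C1; rewrite coef1_mx_act ?(ltnW n_gt1) // mulf_eq0.
rewrite expf_eq0 (negPf diagonal_neq0.2) andbF orbF addr_eq0 => /eqP ->.
by rewrite opprK mulrC mulKf // mulf_neq0 ?ends_neq0.
Qed.

Lemma lower_entry_gt0 : wi0 < v (c ^+ n * B`_0 / (a ^+ n * B`_n)).
Proof.
have n0 := degree_neq0.
suff -> : v (c ^+ n * B`_0 / (a ^+ n * B`_n)) =
    v (B`_1 ^+ n / (B`_0 ^+ n.-1 * B`_n)).
  exact: newton1_gt0.
(* Substituting [lower_entry], the quotients differ only by $(-1)^n$ and $n^n$, both of value 0. *)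
have eqX : c ^+ n * B`_0 / (a ^+ n * B`_n) * n%:R ^+ n =
    (-1) ^+ n * (B`_1 ^+ n / (B`_0 ^+ n.-1 * B`_n)).
  rewrite lower_entry -[- (_ * a)]mulN1r !(exprMn, exprVn) invfM.
  have -> : B`_0 ^+ n = B`_0 * B`_0 ^+ n.-1.
    by rewrite -exprS prednK ?(ltnW n_gt1).
  have [B0 Bn] := ends_neq0.
  set x := a ^+ n; set y := B`_0 ^+ n.-1; set z := n%:R ^+ n.
  have x0 : x != 0 by rewrite expf_neq0 ?diagonal_neq0.
  have y0 : y != 0 by rewrite expf_neq0 ?ends_neq0.
  have z0 : z != 0 by rewrite expf_neq0.
  by field; rewrite x0 y0 z0 B0 Bn.
have := congr1 v eqX; rewrite !vM !vX vn vN1 !mul0rn.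
by rewrite addr0 add0r.
Qed.

(** Here [r] compares the $n$-th power of a term with $n$ times the height of the new segment at
    $j$, which avoids division in $\Gamma$. *)
Lemma term_above_newton_segment i j : (i <= j)%N -> (j <= n)%N ->
  let T := B`_i * (a ^+ i * (c ^+ (j - i) * d ^+ (n - j)) *+ 'C(n - i, j - i)) in
  let r := T ^+ n / ((B`_0 * d ^+ n) ^+ (n - j) * (B`_n * a ^+ n) ^+ j) in
  wi0 <= v r /\ ((i < j)%N -> wi0 < v r).
Proof.
move=> le_ij le_jn T r; have le_in := leq_trans le_ij le_jn.
have [[b0 bn] [a0 d0]] := (ends_neq0, diagonal_neq0).
set s := c ^+ n * B`_0 / (a ^+ n * B`_n).
set q := B`_i ^+ n / (B`_0 ^+ (n - i) * B`_n ^+ i).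
(* The binomial is an integer and [q] is controlled by (D2), so both have value at least 0; [s] has
   positive value and occurs once per factor $c$. *)
have -> : r = 'C(n - i, j - i)%:R ^+ n * q * s ^+ (j - i).
  rewrite /r /T /q mulrnAr -mulr_natl exprMn -!mulrA; congr (_ * _).
  have := @newton_term K B`_0 B`_i B`_n a c d n i (j - i) (n - j) b0 bn a0 d0.
  by rewrite subnKC // [(j - i + _)%N]addnC addnBA // subnK // -mulrA.
have nn_ge0 : wi0 <= v ('C(n - i, j - i)%:R ^+ n * q).
  by rewrite v_ge0M ?newton_ge0 // v_ge0X ?v_ge0_nat.
split; first by rewrite v_ge0M // v_ge0X // ltW // lower_entry_gt0.
by move=> lt_ij; rewrite v_gt0M // v_gt0X ?subn_gt0 // lower_entry_gt0.
Qed.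

Lemma v_lead_mx_act : v C`_n = v (B`_n * a ^+ n).
Proof.
have [[b0 bn] [a0 d0]] := (ends_neq0, diagonal_neq0).
have ba0 : B`_n * a ^+ n != 0 by rewrite mulf_neq0 ?expf_neq0.
(* The term $i=n$ is $b_na^n$; every other term contains $c$. *)
rewrite coef_mx_act // big_ord_recr /= !subnn bin0 !mulr1 mulr1n addrC.
apply: vD_ltl; set t := v _.
apply: (@v_sum_upward _ _ v (fun y => t < v y)).
- by rewrite /t v0 (v_finite v ba0).
- by move=> y z; apply: lt_le_trans.
move=> i _; rewrite /t; apply: (@v_ltX _ _ v _ _ n) => //.
rewrite v_ltE ?expf_neq0 //.
have [_ /(_ (ltn_ord i))] := term_above_newton_segment (ltnW (ltn_ord i)) (leqnn n).
by rewrite !subnn !expr0 mul1r mulr1.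
Qed.

Lemma eisenstein_dumas_mx_act : eisenstein_dumas v n C.
Proof.
have [[b0 bn] [a0 d0]] := (ends_neq0, diagonal_neq0).
have Bn0 : B`_n * a ^+ n != 0 by rewrite mulf_neq0 ?expf_neq0.
have B00 : B`_0 * d ^+ n != 0 by rewrite mulf_neq0 ?expf_neq0.
have Cn0 : C`_n != 0.
  by apply: contraNneq Bn0 => Cn; apply/eqP/(v_infty v); rewrite -v_lead_mx_act Cn v0.
split; first exact: size_mx_act.
- by rewrite mulf_neq0 // coef0_mx_act.
- move=> k k_gt1 /[dup] kn /dvdnP[q nE] [x]; rewrite v_lead_mx_act coef0_mx_act //.
  rewrite !finite_partM ?expf_neq0 // !finite_partX // => Ex.
  have [_ _ D1 _] := edB; case: (D1 k k_gt1 kn).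
  (* The transform adds $n(v(d)-v(a))$ to $v(b_0)-v(b_n)$; with $n=qk$ this is $k$ times the
     subtracted element. *)
  exists (x - (finite_part (v d) - finite_part (v a)) *+ q).
  rewrite mulrnBl -Ex -mulrnA -nE mulrnBl.
  by rewrite opprD addrACA addrK.
- move=> j le_jn; rewrite coef0_mx_act // v_lead_mx_act -!vX -vM.
  rewrite coef_mx_act //; set t := v _.
  apply: (@v_sum_upward _ _ v (fun y => t <= v (y ^+ n))).
  + by rewrite expr0n gtn_eqF ?(ltnW n_gt1) // v0; case: t.
  + by move=> y z ty /(v_leX n); apply: le_trans.
  move=> i _; rewrite /t v_leE ?mulf_neq0 ?expf_neq0 //.
  by have [] := term_above_newton_segment (ltn_ord i : (i <= j)%N) le_jn.
Qed.

End LinearCoefficient.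

Theorem theorem2p6 (K : fieldType) (Gamma : orderedGroupType)
    (v : valuation K Gamma) (n : nat) (A : {poly K}) :
  nontrivial_valuation v ->
  size A = n.+1 ->
  [pchar (residue_field v)]^'.-nat n ->
  (exists B : {poly K}, in_lower_orbit n A B /\ eisenstein_dumas v n B) ->
  [/\ A`_0 != 0,
      (let u := tofrac (1 - (A`_1 / (n%:R * A`_0)) *: 'X) in
       tofrac (L_transform n A) = u ^+ n * eval_ratfun A (tofrac 'X / u))
    & (1 < n)%N -> eisenstein_dumas v n (L_transform n A)].
Proof.
move=> _ sA pn [B [[g [[g_trig gU] BE]] edB]].
have g01 : g 0 1 = 0 by apply: (is_trig_mxP g_trig).
have vn := v_natr_eq0 pn.
(* From $b_0=a_0d^n\neq0$ follows $a_0\neq0$. *)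
have [_ + _ _] := edB; rewrite mulf_eq0 negb_or BE => /andP[+ _].
rewrite coef0_mx_act // mulf_eq0 negb_or => /andP[A0 _].
set e := - (A`_1 / (n%:R * A`_0)).
have hU : mx2 1 0 e 1 \in unitmx.
  by rewrite unitmxE det_mx22 !mxE /= !mul1r mul0r subr0 unitr1.
split=> // [u|n_gt1].
  rewrite /L_transform mx_actE ?sA // !mxE /= scale1r addr0 addrC.
  by rewrite /u -scaleNr.
(* Since $B=Ag$, applying $h$ to $A$ is applying $g^{-1}h$ to $B$. *)
pose g' := invmx g *m mx2 1 0 e 1.
have LE : L_transform n A = mx_act n B g'.
  by rewrite BE mx_actM ?unitmx_mul ?unitmx_inv ?gU // mulmxA mulmxV // mul1mx.
rewrite LE; apply: eisenstein_dumas_mx_act => //.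
(* The upper right entry of $gg'=h$ is 0 and equals $g_{00}g'_{01}$, with $g_{00}\neq0$. *)
- have : (g *m g') 0 1 = 0 by rewrite mulKVmx // mxE.
  rewrite mxE !big_ord_recl big_ord0 addr0.
  rewrite (_ : lift ord0 ord0 = 1); last exact: val_inj.
  rewrite g01 mul0r addr0 => /eqP.
  by rewrite mulf_eq0 (negPf (diagonal_neq0 g01 gU).1) => /eqP.
- by rewrite unitmx_mul unitmx_inv gU.
(* The entry [e] was chosen so that $a_1+na_0e=0$. *)
rewrite -LE /L_transform coef1_mx_act ?(ltnW n_gt1) ?mxE //= mulr1.
rewrite mulrN mulrCA divff ?mulr1 ?subrr ?mul0r //.
by rewrite mulf_neq0 // (degree_neq0 vn).
Qed.
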